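(* Let $(X,\mathcal{A},\mu)$ be a measure space and let $I$ be an ideal of the ring $\mathcal{M}(X,\mathcal{A})$. The following statements are equivalent for an ideal $J$ in the ring $\mathcal{M}(X,\mathcal{A})$. (1) $J$ is a connected ideal in the $m_{\mu_I}$-topology (i.e. $J$ is a connected subset of $\mathcal{M}(X,\mathcal{A})$ with the $m_{\mu_I}$-topology). (2) $J\subseteq L_I^\infty(\mu)$. (3) $J\subseteq I\mu(X,\mathcal{A})$.
   Context: $X$ is a non-empty set, $\mathcal{A}$ a $\sigma$-algebra on $X$, and $\mu:\mathcal{A}\to[0,\infty]$ a measure. $\mathcal{M}(X,\mathcal{A})$ is the commutative ring with unity of all real-valued $\mathcal{A}$-measurable functions on $X$, with pointwise operations. For $g\in\mathcal{M}(X,\mathcal{A})$, $Z(g)=\{x\in X: g(x)=0\}$, and for an ideal $I$, $Z[I]=\{Z(g): g\in I\}$. Null sets $E$ below are always members of $\mathcal{A}$. $L_I^\infty(\mu)$ is the set of all $f\in\mathcal{M}(X,\mathcal{A})$ for which there exist $Z\in Z[I]$ and $E\subseteq Z$ with $\mu(E)=0$ such that $f$ is bounded on $Z\setminus E$. $I\mu(X,\mathcal{A})$ is the set of all $f\in\mathcal{M}(X,\mathcal{A})$ such that for every $g\in\mathcal{M}(X,\mathcal{A})$ there exist $Z\in Z[I]$ and $E\subseteq Z$ with $\mu(E)=0$ such that $fg$ is bounded on $Z\setminus E$. $U_{\mu_I}^+$ is the set of all $u\in\mathcal{M}(X,\mathcal{A})$ for which there exist $Z\in Z[I]$ and $E\subseteq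 Z$ with $\mu(E)=0$ such that $u(x)>0$ for all $x\in Z\setminus E$. For $f\in\mathcal{M}(X,\mathcal{A})$ and $u\in U_{\mu_I}^+$, $m_{\mu_I}(f,u)$ is the set of all $g\in\mathcal{M}(X,\mathcal{A})$ for which there exist $Z\in Z[I]$ and $E\subseteq Z$ with $\mu(E)=0$ such that $|g(x)-f(x)|<u(x)$ for all $x\in Z\setminus E$. The sets $m_{\mu_I}(f,u)$ ($f\in\mathcal{M}(X,\mathcal{A})$, $u\in U_{\mu_I}^+$) form an open base for a topology on $\mathcal{M}(X,\mathcal{A})$, called the $m_{\mu_I}$-topology. *)

(* Defs.v *)
From HB Require Import structures.
From mathcomp Require Import all_boot all_order all_algebra.
From mathcomp Require Import all_classical all_reals all_analysis measurable_realfun.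

Set Implicit Arguments.
Unset Strict Implicit.
Unset Printing Implicit Defensive.

Import Order.TTheory GRing.Theory Num.Theory.
Import numFieldNormedType.Exports.

Local Open Scope classical_set_scope.
Local Open Scope ring_scope.

(* Ideals need not be proper, unlike those of [GRing.idealr_closed].          *)
Definition is_ideal (A : comNzRingType) (I : set A) : Prop :=
  [/\ I 0,
      forall f g : A, I f -> I g -> I (f + g) &
      forall a f : A, I f -> I (a * f)].

Definition zero_set d (X : measurableType d) (R : realType)
    (g : {mfun X >-> R}) : set X :=
  [set x | g x = 0].

Definition zero_sets d (X : measurableType d) (R : realType)
    (I : set {mfun X >-> R}) : set (set X) :=
  [set zero_set g | g in I].

Definition ae_on_zero_set d (X : measurableType d) (R : realType)
    (mu : {measure set X -> \bar R}) (I : set {mfun X >-> R})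
    (Q : set X -> Prop) : Prop :=
  exists Z E : set X,
    [/\ zero_sets I Z, measurable E, E `<=` Z, mu E = 0%E & Q (Z `\` E)].

Definition LinftyI d (X : measurableType d) (R : realType)
    (mu : {measure set X -> \bar R}) (I : set {mfun X >-> R}) :
    set {mfun X >-> R} :=
  [set f | ae_on_zero_set mu I (fun A => [bounded f x | x in A])].

Definition Imu d (X : measurableType d) (R : realType)
    (mu : {measure set X -> \bar R}) (I : set {mfun X >-> R}) :
    set {mfun X >-> R} :=
  [set f | forall g : {mfun X >-> R},
     ae_on_zero_set mu I (fun A => [bounded (f * g) x | x in A])].

Definition Uplus d (X : measurableType d) (R : realType)
    (mu : {measure set X -> \bar R}) (I : set {mfun X >-> R}) :
    set {mfun X >-> R} :=
  [set u | ae_on_zero_set mu I (fun A => forall x, A x -> 0 < u x)].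

Definition mball d (X : measurableType d) (R : realType)
    (mu : {measure set X -> \bar R}) (I : set {mfun X >-> R})
    (f u : {mfun X >-> R}) : set {mfun X >-> R} :=
  [set g | ae_on_zero_set mu I (fun A => forall x, A x -> `|g x - f x| < u x)].

Definition mbase d (X : measurableType d) (R : realType)
    (mu : {measure set X -> \bar R}) (I : set {mfun X >-> R}) :
    set (set {mfun X >-> R}) :=
  [set B | exists f u, Uplus mu I u /\ B = mball mu I f u].

Section base.
Context d (X : measurableType d) (R : realType).
Variables (mu : {measure set X -> \bar R}) (I : set {mfun X >-> R}).
Hypothesis idI : is_ideal I.

Lemma zero_setsI Z1 Z2 :
  zero_sets I Z1 -> zero_sets I Z2 -> zero_sets I (Z1 `&` Z2).
Proof.
case: idI => _ ID IM [f If <-] [g Ig <-].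
exists (f * f + g * g); first by apply: ID; exact: IM.
apply/seteqP; split => x.
  change (f x * f x + g x * g x = 0 -> f x = 0 /\ g x = 0).
  move=> /eqP; rewrite -!expr2 paddr_eq0 ?sqr_ge0// !sqrf_eq0.
  by case/andP => /eqP ? /eqP ?.
change (f x = 0 /\ g x = 0 -> f x * f x + g x * g x = 0).
by case=> -> ->; rewrite !mulr0 addr0.
Qed.

Lemma ae_on_zero_setI (P Q : X -> Prop) :
  ae_on_zero_set mu I (fun A => forall x, A x -> P x) ->
  ae_on_zero_set mu I (fun A => forall x, A x -> Q x) ->
  ae_on_zero_set mu I (fun A => forall x, A x -> P x /\ Q x).
Proof.
move=> [Z1 [E1 [hZ1 mE1 _ E10 P1]]] [Z2 [E2 [hZ2 mE2 _ E20 Q2]]].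
have hZ := zero_setsI hZ1 hZ2.
have mZ : measurable (Z1 `&` Z2).
  case: hZ => h _ <-.
  have := measurable_funPT h measurableT _ (measurable_set1 (0 : R)).
  by rewrite setTI.
have mE : measurable (E1 `|` E2) by exact: measurableU.
exists (Z1 `&` Z2), ((Z1 `&` Z2) `&` (E1 `|` E2)); split => //.
- exact: measurableI.
- apply: (@subset_measure0 _ _ _ mu _ (E1 `|` E2)) => //.
    exact: measurableI.
  exact: (null_set_setU (mu := mu)).
- move=> x [[Z1x Z2x] /= nE]; split.
  + by apply: P1; split => // E1x; apply: nE; split => //; left.
  + by apply: Q2; split => // E2x; apply: nE; split => //; right.
Qed.

Lemma ae_on_zero_setS (P Q : X -> Prop) : (forall x, P x -> Q x) ->
  ae_on_zero_set mu I (fun A => forall x, A x -> P x) ->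
  ae_on_zero_set mu I (fun A => forall x, A x -> Q x).
Proof.
move=> PQ [Z [E [hZ mE EZ E0 hP]]]; exists Z, E; split => //.
by move=> x /hP /PQ.
Qed.

Lemma ae_on_zero_setT (P : X -> Prop) : (forall x, P x) ->
  ae_on_zero_set mu I (fun A => forall x, A x -> P x).
Proof.
move=> hP; case: idI => I0 _ _; exists (zero_set (0 : {mfun X >-> R})), set0.
by split => //; exists 0.
Qed.

Lemma mbase_cover : \bigcup_(B in mbase mu I) id B = setT.
Proof.
apply/seteqP; split => // f _; exists (mball mu I f 1).
  by exists f, 1; split => //; apply: ae_on_zero_setT => x; exact: ltr01.
by apply: ae_on_zero_setT => x; rewrite subrr normr0; exact: ltr01.
Qed.

Lemma mbase_join (B C : set {mfun X >-> R}) h :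
  mbase mu I B -> mbase mu I C -> id B h -> id C h ->
  exists D, [/\ mbase mu I D, id D h & id D `<=` id B `&` id C].
Proof.
move=> [f [u [_ ->]]] [g [v [_ ->]]] hu hv.
pose w : {mfun X >-> R} :=
  min_mfun (u - (@Num.norm R R \o (h - f) : {mfun X >-> R}))
           (v - (@Num.norm R R \o (h - g) : {mfun X >-> R})).
have wE x : w x = Num.min (u x - `|h x - f x|) (v x - `|h x - g x|) by [].
have w0 : Uplus mu I w.
  apply: ae_on_zero_setS (ae_on_zero_setI hu hv) => x [ux vx].
  by rewrite wE lt_min !subr_gt0 ux.
exists (mball mu I h w); split.
- by exists h, w.
- by apply: ae_on_zero_setS w0 => x; rewrite subrr normr0.
- move=> k hk; split; apply: ae_on_zero_setS hk => x;
    rewrite wE lt_min !ltrBrDr => /andP[k1 k2].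
  + by apply: le_lt_trans k1; exact: ler_distD.
  + by apply: le_lt_trans k2; exact: ler_distD.
Qed.

End base.

(* A copy of M(X, A) carrying the m_{mu_I}-topology.                          *)
Definition mspace d (X : measurableType d) (R : realType)
    (mu : {measure set X -> \bar R}) (I : set {mfun X >-> R})
    (idI : is_ideal I) : Type :=
  {mfun X >-> R}.

HB.instance Definition _ d (X : measurableType d) (R : realType)
    (mu : {measure set X -> \bar R}) (I : set {mfun X >-> R})
    (idI : is_ideal I) :=
  Choice.on (mspace mu idI).

HB.instance Definition _ d (X : measurableType d) (R : realType)
    (mu : {measure set X -> \bar R}) (I : set {mfun X >-> R})
    (idI : is_ideal I) :=
  isBaseTopological.Build (mspace mu idI) (mbase_cover mu idI)
    (@mbase_join _ _ _ mu _ idI).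

Lemma mspace_openE d (X : measurableType d) (R : realType)
    (mu : {measure set X -> \bar R}) (I : set {mfun X >-> R})
    (idI : is_ideal I) (O : set (mspace mu idI)) :
  open O <-> exists2 D, D `<=` mbase mu I & \bigcup_(B in D) B = O.
Proof. by []. Qed.

(* Main.v *)
Require Import Defs.
From mathcomp Require Import all_boot all_order all_algebra.
From mathcomp Require Import all_classical all_reals all_analysis measurable_realfun.

(** Call a property of the points of [X] generic when it holds on some zero
    set of [I] minus a null set; generic properties are stable under finite
    conjunction.

    The functions that are generically bounded form a clopen set: a function
    that is generically within distance 1 of [f] is generically bounded exactly
    when [f] is ([LinftyI_clopen]). A connected ideal contains 0, which is
    bounded, so it stays inside this clopen set.

    An ideal of generically bounded functions is stable under multiplication,
    so all the products [f * g] with [f] in the ideal are generically bounded as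
    well, which is the condition defining [Imu].

    If [f] is in [Imu], the line [t |-> t f] is continuous
    ([continuous_line]): to have [|s f - t f| < u] generically for [s] close
    to [t], it suffices that [f / u] be generically bounded, and this is the
    condition defining [Imu] at [g = 1 / u]. An ideal contained in [Imu] is thus
    a union of connected lines through 0. *)

Set Implicit Arguments.
Unset Strict Implicit.
Unset Printing Implicit Defensive.

Import Order.TTheory GRing.Theory Num.Theory.
Import numFieldNormedType.Exports.

Local Open Scope classical_set_scope.
Local Open Scope ring_scope.

Section connected_ideals.
Context d (X : measurableType d) (R : realType).
Variables (mu : {measure set X -> \bar R}) (I : set {mfun X >-> R}).
Hypothesis idI : is_ideal I.

Local Notation generically P := (ae_on_zero_set mu I (fun A => forall x, A x -> P x)).

(** The bound is taken positive so that it can be a denominator. *)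
Lemma ae_boundedP (f : X -> R) :
  ae_on_zero_set mu I (fun A => [bounded f x | x in A]) <->
  exists2 M : R, 0 < M & generically (fun x => `|f x| <= M).
Proof.
split=> [[Z [E [hZ mE EZ E0 /pinfty_ex_gt0[M M0 fM]]]]|
         [M M0 [Z [E [hZ mE EZ E0 fM]]]]].
  by exists M => //; exists Z, E.
exists Z, E; split => //; exists M; split; first exact: num_real.
by move=> N /ltW MN x /fM /le_trans; apply.
Qed.

Lemma LinftyI0 : LinftyI mu I 0.
Proof.
apply/ae_boundedP; exists 1 => //; apply: ae_on_zero_setT => // x.
by rewrite normr0.
Qed.

Lemma LinftyI_near (f g : {mfun X >-> R}) :
  mball mu I f 1 g -> LinftyI mu I f -> LinftyI mu I g.
Proof.
move=> fg /ae_boundedP[M M0 fM]; apply/ae_boundedP.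
exists (1 + M); first by rewrite addr_gt0.
apply: ae_on_zero_setS (ae_on_zero_setI idI fg fM) => x [gfx fx].
rewrite -[g x](subrK (f x)) (le_trans (ler_normD _ _))// lerD//.
exact: ltW gfx.
Qed.

Lemma mball_sym (f g u : {mfun X >-> R}) :
  mball mu I f u g -> mball mu I g u f.
Proof. by apply: ae_on_zero_setS => x; rewrite distrC. Qed.

Lemma mball_center (f u : {mfun X >-> R}) : Uplus mu I u -> mball mu I f u f.
Proof. by apply: ae_on_zero_setS => x; rewrite subrr normr0. Qed.

Lemma Uplus1 : Uplus mu I 1.
Proof. by apply: ae_on_zero_setT => // x; exact: ltr01. Qed.

Lemma open_mball (f u : {mfun X >-> R}) :
  Uplus mu I u -> open (mball mu I f u : set (mspace mu idI)).
Proof.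
move=> u0; apply/mspace_openE; exists [set mball mu I f u].
  by move=> _ ->; exists f, u.
by rewrite bigcup_set1.
Qed.

(** The base sets containing [g] need not be centred at [g]; the radius
    [u - |g - f|] recentres the base set of centre [f] and radius [u]. *)
Lemma mspace_nbhsP (g : mspace mu idI) (B : set (mspace mu idI)) :
  nbhs g B <-> exists2 u : {mfun X >-> R}, Uplus mu I u & mball mu I g u `<=` B.
Proof.
split; last first.
  move=> [u u0 uB]; rewrite nbhsE /=; exists (mball mu I g u) => //.
  by split; [exact: open_mball|exact: mball_center].
rewrite nbhsE => -[_ [/mspace_openE[D DB <-] [C DC Cg]] CB].
have [f [u [_ CE]]] := DB _ DC; rewrite CE in Cg.
pose v : {mfun X >-> R} :=
  u - (@Num.norm R R \o ((g : {mfun X >-> R}) - f) : {mfun X >-> R}).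
have vE x : v x = u x - `|g x - f x| by [].
exists v; first by apply: ae_on_zero_setS Cg => x; rewrite vE subr_gt0.
move=> h gh; apply: CB; exists C => //; rewrite CE.
apply: ae_on_zero_setS gh => x; rewrite vE ltrBrDr.
by apply: le_lt_trans; exact: ler_distD.
Qed.

Lemma LinftyI_clopen :
  open (LinftyI mu I : set (mspace mu idI)) /\
  closed (LinftyI mu I : set (mspace mu idI)).
Proof.
split; last (rewrite -[LinftyI _ _]setCK; apply: open_closedC);
  rewrite openE => f Lf; apply/mspace_nbhsP; exists 1 => //;
  try exact: Uplus1; move=> g fg.
- exact: LinftyI_near fg Lf.
- by move=> Lg; apply: Lf; apply: LinftyI_near Lg; exact: mball_sym.
Qed.

Lemma connected_LinftyI (J : set {mfun X >-> R}) :
  connected (J : set (mspace mu idI)) -> J 0 -> J `<=` LinftyI mu I.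
Proof.
have [oL cL] := LinftyI_clopen.
move=> cJ J0; apply/setIidPl; apply: cJ.
- by exists 0; split => //; exact: LinftyI0.
- by exists (LinftyI mu I).
- by exists (LinftyI mu I).
Qed.

Lemma ideal_LinftyI_Imu (J : set {mfun X >-> R}) :
  is_ideal J -> J `<=` LinftyI mu I -> J `<=` Imu mu I.
Proof. by move=> [_ _ JM] JL f Jf g; apply: JL; rewrite mulrC; exact: JM. Qed.

(** A measurable function that inverts [u] wherever [u] is positive; real
    powers provide its measurability. *)
Definition recip_mfun (u : {mfun X >-> R}) : {mfun X >-> R} :=
  mfun_Sub (mem_set (measurableT_comp (measurable_powR (-1)) (measurable_funPT u))).

Lemma recip_mfunE (u : {mfun X >-> R}) x : 0 < u x -> recip_mfun u x = (u x)^-1.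
Proof. by move=> /ltW u0; exact: powR_inv1. Qed.

Definition line (f : {mfun X >-> R}) (t : R) : mspace mu idI :=
  (cst t : {mfun X >-> R}) * f.

Lemma continuous_line (f : {mfun X >-> R}) : Imu mu I f -> continuous (line f).
Proof.
move=> If t B /mspace_nbhsP[u u0 uB].
have /ae_boundedP[M M0 fuM] := If (recip_mfun u).
apply/nbhs_ballP; exists M^-1; first by rewrite /= invr_gt0.
move=> s ts; apply: uB.
apply: ae_on_zero_setS (ae_on_zero_setI idI u0 fuM) => x [ux].
change (`|f x * recip_mfun u x| <= M -> `|s * f x - t * f x| < u x).
rewrite recip_mfunE// normrM (gtr0_norm (x := _^-1)) ?invr_gt0//.
rewrite ler_pdivrMr// => fx; rewrite -mulrBl normrM.
apply: (@le_lt_trans _ _ (`|s - t| * (M * u x))); first exact: ler_wpM2l.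
rewrite mulrA gtr_pMl// -ltr_pdivlMr// div1r distrC; exact: ts.
Qed.

Lemma ideal_Imu_connected (J : set {mfun X >-> R}) :
  is_ideal J -> J `<=` Imu mu I -> connected (J : set (mspace mu idI)).
Proof.
move=> [J0 _ JM] JI.
have -> : J = \bigcup_(f in J) range (line f).
  apply/seteqP; split=> [f Jf|_ [f Jf [t _ <-]]]; last exact: JM.
  by exists f => //; exists 1 => //; apply/mfuneqP => x; exact: mul1r.
apply: bigcup_connected.
  by exists 0 => f Jf; exists 0 => //; apply/mfuneqP => x; exact: mul0r.
move=> f /JI If; apply: connected_continuous_connected.
  by apply/connected_intervalP => ? ?.
by apply: continuous_subspaceT; exact: continuous_line.
Qed.

End connected_ideals.

Unset Implicit Arguments.

Theorem theorem2p8 (d : measure_display) (X : measurableType d) (R : realType)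
    (mu : {measure set X -> \bar R})
    (I : set {mfun X >-> R}) (idI : is_ideal I)
    (J : set {mfun X >-> R}) (idJ : is_ideal J) :
  [<-> connected (J : set (mspace mu idI));
       J `<=` LinftyI mu I;
       J `<=` Imu mu I].
Proof.
have [J0 _ _] := idJ.
tfae.
- by move=> cJ; exact: connected_LinftyI cJ J0.
- exact: ideal_LinftyI_Imu.
- exact: ideal_Imu_connected.
Qed.
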